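(* Let $f\colon X\to[-\infty,+\infty]$ be a function. (i) If $f$ is $(K,N)$-convex for some $K\ge0$ and $N<0$, then $f_N=e^{-f/N}$ is convex (i.e. $0$-convex). (ii) If $f$ is bounded above by $M$ and $(K,N)$-convex for some $K<0$ and $N<0$, then $f_N=e^{-f/N}$ is $\lambda$-convex with $\lambda=-\frac KN e^{-M/N}$.
   Context: Setting. $(X,d)$ is a metric space, not necessarily complete, which is strictly intrinsic (any two points are joined by a geodesic in $X$) and whose metric completion is geodesic (complete and strictly intrinsic). A geodesic is a continuous curve $\gamma\colon[0,1]\to X$ with $d(\gamma_s,\gamma_t)=|t-s|\,d(\gamma_0,\gamma_1)$ for all $s,t\in[0,1]$. For $g\colon X\to[-\infty,+\infty]$: $\mathcal D[g]=\{x: g(x)\ne\pm\infty\}$ and $\mathcal D^\star[g]=\{x: g(x)<+\infty\}$; it is assumed that $\mathcal D[f]\ne\emptyset$. For $N<0$, $f_N:=e^{-f/N}$, with $f_N=0$ where $f=-\infty$ and $f_N=+\infty$ where $f=+\infty$. $\lambda$-convexity ($\lambda\in\mathbb R$). $g\colon X\to[-\infty,+\infty]$ is $\lambda$-convex if for all $x_0,x_1\in\mathcal D[g]$ there is a geodesic $\gamma\colon[0,1]\to X$ from $x_0$ to $x_1$ with $g(\gamma_t)\le(1-t)g(x_0)+tg(x_1)-\frac\lambda2t(1-t)d(x_0,x_1)^2$ for all $t\in[0,1]$. Functions. For $\theta\ge0$: $\mathfrak s_{K,N}(\theta)=\frac{\sin(\theta\sqrt{K/N})}{\sqrt{K/N}}$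 if $K<0$, $=\theta$ if $K=0$, $=\frac{\sinh(\theta\sqrt{-K/N})}{\sqrt{-K/N}}$ if $K>0$. For $t\in[0,1]$: $\sigma^{(t)}_{K,N}(\theta)=\frac{\mathfrak s_{K,N}(t\theta)}{\mathfrak s_{K,N}(\theta)}$ if $N\pi^2<K\theta^2<0$ or $K\theta^2>0$; $=t$ if $K\theta^2=0$; $=+\infty$ if $K\theta^2\le N\pi^2$. $(K,N)$-convexity ($K\in\mathbb R$, $N<0$). $f$ is $(K,N)$-convex if for all $x_0,x_1\in\mathcal D^\star[f]$, with $d(x_0,x_1)<\pi\sqrt{N/K}$ when $K<0$, there is a geodesic $\gamma\colon[0,1]\to X$ from $x_0$ to $x_1$ such that, with $\delta=d(x_0,x_1)$, $f_N(\gamma_t)\le\sigma^{(1-t)}_{K,N}(\delta)f_N(x_0)+\sigma^{(t)}_{K,N}(\delta)f_N(x_1)$ for all $t\in[0,1]$ (convention $0\cdot\infty=0$). *)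

(* Defs.v *)
From HB Require Import structures.
From mathcomp Require Import all_boot all_order all_algebra.
From mathcomp Require Import all_classical all_reals all_analysis.

Set Implicit Arguments.
Unset Strict Implicit.
Unset Printing Implicit Defensive.

Import Order.TTheory GRing.Theory Num.Theory.
Import numFieldNormedType.Exports.

Local Open Scope classical_set_scope.
Local Open Scope ring_scope.

Section MetricNotions.
Context {R : realType}.

(* Curves are total functions on R, of which only the restriction to [0, 1]
   is constrained. *)
Definition geodesic (X : metricType R) (gamma : R -> X) : Prop :=
  {within `[0, 1]%classic, continuous gamma} /\
  forall s t : R, 0 <= s <= 1 -> 0 <= t <= 1 ->
    mdist (gamma s) (gamma t) = `|t - s| * mdist (gamma 0) (gamma 1).

Definition geodesic_from_to (X : metricType R) (x0 x1 : X) (gamma : R -> X)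
    : Prop :=
  [/\ geodesic gamma, gamma 0 = x0 & gamma 1 = x1].

Definition strictly_intrinsic (X : metricType R) : Prop :=
  forall x0 x1 : X, exists gamma : R -> X, geodesic_from_to x0 x1 gamma.

(* The library's [completeType] bundles a distinguished point, hence the
   unbundled form of its axiom. *)
Definition complete_space (X : metricType R) : Prop :=
  forall F : set_system X, ProperFilter F -> cauchy F ->
    exists x : X, F --> x.

Definition geodesic_space (X : metricType R) : Prop :=
  complete_space X /\ strictly_intrinsic X.

(* [iota : X -> Y] exhibits Y as the metric completion of X, which is
   characterised by this property up to a unique isometry over X. *)
Definition metric_completion (X Y : metricType R) (iota : X -> Y) : Prop :=
  [/\ complete_space Y,
      forall x x' : X, mdist (iota x) (iota x') = mdist x x'
    & dense (range iota)].

End MetricNotions.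

Section Convexity.
Context {R : realType} {X : metricType R}.

Definition fin_dom (g : X -> \bar R) : set X := [set x | g x \is a fin_num].

Definition lty_dom (g : X -> \bar R) : set X := [set x | (g x < +oo)%E].

(* e^{-f/N}, meant for N < 0: hence the values at -oo and +oo. *)
Definition exp_transform (N : R) (f : X -> \bar R) (x : X) : \bar R :=
  match f x with
  | r%:E => (expR (- r / N))%:E
  | +oo%E => +oo%E
  | -oo%E => 0%E
  end.

Definition lambda_convex (lambda : R) (g : X -> \bar R) : Prop :=
  forall x0 x1 : X, fin_dom g x0 -> fin_dom g x1 ->
  exists2 gamma : R -> X, geodesic_from_to x0 x1 gamma &
    forall t : R, 0 <= t <= 1 ->
      (g (gamma t) <= (1 - t)%:E * g x0 + t%:E * g x1
                      - (lambda / 2 * t * (1 - t) * mdist x0 x1 ^+ 2)%:E)%E.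

Definition sinh (x : R) : R := (expR x - expR (- x)) / 2.

Definition sfun (K N theta : R) : R :=
  if K < 0 then sin (theta * Num.sqrt (K / N)) / Num.sqrt (K / N)
  else if K == 0 then theta
  else sinh (theta * Num.sqrt (- K / N)) / Num.sqrt (- K / N).

(* The last case is K * theta ^+ 2 <= N * pi ^+ 2. *)
Definition sigma (K N t theta : R) : \bar R :=
  if (N * pi ^+ 2 < K * theta ^+ 2 < 0) || (0 < K * theta ^+ 2)
  then (sfun K N (t * theta) / sfun K N theta)%:E
  else if K * theta ^+ 2 == 0 then t%:E
  else +oo%E.

(* The convention 0 * oo = 0 is that of the product on \bar R. *)
Definition KN_convex (K N : R) (f : X -> \bar R) : Prop :=
  forall x0 x1 : X, lty_dom f x0 -> lty_dom f x1 ->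
  (K < 0 -> mdist x0 x1 < pi * Num.sqrt (N / K)) ->
  exists2 gamma : R -> X, geodesic_from_to x0 x1 gamma &
    forall t : R, 0 <= t <= 1 ->
      (exp_transform N f (gamma t) <=
         sigma K N (1 - t) (mdist x0 x1) * exp_transform N f x0
         + sigma K N t (mdist x0 x1) * exp_transform N f x1)%E.

End Convexity.

(* Main.v *)
(** Part (i): [sigma K N t theta <= t], because sinh is convex on the
    half-line and vanishes at 0.

    Part (ii): put [h = f_N], [B = e^{-M/N}], [c = sqrt (K / N)] and
    [phi = c d(x, y)].  The geodesic that (K, N)-convexity attaches to (x, y)
    need not satisfy the claim, even when x and y are close: its bound solves
    [S'' = - phi^2 S] and may exceed B, whereas the target has second derivative
    [- phi^2 B].  Instead, subdivide: among the chains [p_0 = x, ..., p_n = y]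
    with steps [d(x, y) / n], take one that minimises [\sum_i h (p_i)] up to eps.
    Replacing [p_i] by the midpoint of the geodesic attached to
    [(p_{i-1}, p_{i+1})] cannot decrease the sum by more than eps, hence
    [h (p_i) <= (h (p_{i-1}) + h (p_{i+1})) / (2 cos psi) + eps] for
    [psi = phi / n].  As [1 - cos psi < psi^2 / 2] strictly, for small eps the
    discrete maximum principle puts [h (p_i)] below a parabola that is less
    curved than the target.  This gain absorbs the error made when consecutive
    points of the chain are joined by the attached geodesics, so no limit is
    taken and no completeness is needed. *)

Require Import Defs.
From HB Require Import structures.
From mathcomp Require Import all_boot all_order all_algebra.
From mathcomp Require Import all_classical all_reals all_analysis.
From mathcomp Require Import ring lra.

Set Implicit Arguments.
Unset Strict Implicit.
Unset Printing Implicit Defensive.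

Import Order.TTheory GRing.Theory Num.Theory.
Import numFieldNormedType.Exports.

Local Open Scope classical_set_scope.
Local Open Scope ring_scope.

(** * Convexity on the half-line and along finite sequences *)

(** The mean value theorem on [[0, t x]] and on [[t x, x]] gives two slopes, ordered because [dF] is
    monotone. *)
Lemma le_scale_of_nondecreasing_derive (R : realType) (F dF : R -> R) (x t : R) :
  (forall y : R, is_derive y 1 F (dF y)) -> F 0 = 0 ->
  {in `[0, x] &, {homo dF : a b / a <= b}} ->
  0 <= x -> 0 <= t <= 1 -> F (t * x) <= t * F x.
Proof.
move=> dFE F0 dFmono x0 /andP[t0 t1].
have cF a b : {within `[a, b], continuous F}.
  apply: continuous_subspaceT => y.
  by apply: differentiable_continuous; apply/derivable1_diffP; exact: ex_derive.
have tx0 : 0 <= t * x by rewrite mulr_ge0.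
have txx : t * x <= x by rewrite ler_piMl.
have [c1 /[!in_itv]/= /andP[c10 c1t]] :=
  MVT_segment tx0 (fun y _ => dFE y) (@cF _ _).
rewrite F0 !subr0 => E1.
have [c2 /[!in_itv]/= /andP[c2t c2x] E2] :=
  MVT_segment txx (fun y _ => dFE y) (@cF _ _).
have c12 : dF c1 <= dF c2.
  by apply: dFmono; rewrite ?in_itv/=; lra.
rewrite -subr_ge0.
have -> : t * F x - F (t * x) = (t * (1 - t) * x) * (dF c2 - dF c1).
  have -> : F x = F (t * x) + dF c2 * (x - t * x) by rewrite -E2; ring.
  by rewrite E1; ring.
by rewrite !mulr_ge0// subr_ge0.
Qed.

Lemma sin_le_id (R : realType) (x : R) : 0 <= x -> sin x <= x.
Proof.
move=> x0.
have cS : {within `[0, x], continuous (@sin R)}.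
  by apply: continuous_subspaceT => y; exact: continuous_sin.
have [c _] := MVT_segment x0 (fun y _ => is_derive_sin y) cS.
by rewrite sin0 !subr0 => ->; rewrite ler_piMl// cos_le1.
Qed.

Lemma sinh_scale (R : realType) (x t : R) :
  0 <= x -> 0 <= t <= 1 -> sinh (t * x) <= t * sinh x.
Proof.
apply: (@le_scale_of_nondecreasing_derive _ _
  (fun y => (expR y + expR (- y)) / 2)).
- move=> y; rewrite /sinh.
  apply: is_derive_eq.
  rewrite /GRing.scale /=; ring.
- by rewrite /sinh oppr0 subrr mul0r.
- move=> a b /[!in_itv]/= /andP[a0 _] /andP[b0 _] ab.
  rewrite !expRN.
  have a1 : 1 <= expR a by rewrite -expR0 ler_expR.
  have ab' : expR a <= expR b by rewrite ler_expR.
  have b1 : 1 <= expR b by lra.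
  rewrite -subr_ge0.
  set u := expR a in a1 ab' *; set v := expR b in ab' b1 *.
  have -> : (v + v^-1) / 2 - (u + u^-1) / 2 = (v - u) * (u * v - 1) / (u * v) / 2.
    by field; rewrite !gt_eqF//; lra.
  rewrite !divr_ge0 ?mulr_ge0//; nra.
Qed.

(** Concavity of [sin] on [[0, pi]]: [- cos] is nondecreasing there. *)
Lemma sin_scale (R : realType) (x t : R) :
  0 <= x <= pi -> 0 <= t <= 1 -> t * sin x <= sin (t * x).
Proof.
move=> /andP[x0 xpi] t01; rewrite -lerN2 -mulrN.
apply: (@le_scale_of_nondecreasing_derive _ (fun y => - sin y)
  (fun y => - cos y)) => //.
- by rewrite sin0 oppr0.
- move=> a b /[!in_itv]/= /andP[a0 ax] /andP[b0 bx] ab.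
  by rewrite lerN2 leNgt ltr_cos ?in_itv/= -?leNgt //; apply/andP; split; lra.
Qed.

(** Discrete maximum principle: a convex sequence lies below its chords. *)
Lemma discrete_convex_le0 (R : realFieldType) (n : nat) (u : nat -> R) :
  u 0%N <= 0 -> u n <= 0 ->
  (forall i, (0 < i < n)%N -> 2 * u i <= u i.-1 + u i.+1) ->
  forall i, (i <= n)%N -> u i <= 0.
Proof.
move=> u0 un ucvx.
(* The chord from 0 to [i.+1], evaluated at [i] and cleared of its denominator. *)
have slope i : (i < n)%N -> i.+1%:R * u i <= i%:R * u i.+1 + (u 0%N).
  elim: i => [|i IHi] lin; first by rewrite mul1r mul0r add0r.
  have {IHi}IH := IHi (ltnW lin).
  have := ucvx i.+1 lin; rewrite /= => uc.
  have i1 : 0 <= i.+1%:R :> R by [].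
  have {uc} := ler_wpM2l i1 uc.
  have E1 : i.+1%:R = i%:R + 1 :> R by rewrite natr1.
  have E2 : i.+2%:R = i%:R + 2 :> R by rewrite -natrD addn2.
  by move: IH; rewrite E1 E2; lra.
move=> i; rewrite -(subKn (leqnn n)) => lin.
have {lin} : (i <= n)%N by rewrite subKn // in lin.
(* Descending induction from [n]: since [u 0 <= 0], [slope] passes the sign from [i.+1] to [i]. *)
elim: {i} (n - i)%N {-2}i (erefl (n - i)%N) => [|k IHk] i nik lin.
  by have -> : i = n by apply/eqP; rewrite eqn_leq lin -subn_eq0 nik.
have lt_in : (i < n)%N by rewrite -subn_gt0 nik.
have ui1 : u i.+1 <= 0 by apply: IHk => //; rewrite subnS nik.
have s := slope i lt_in.
have i0 : 0 <= i%:R :> R by [].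
rewrite -natr1 in s; nra.
Qed.

(** * A criterion for geodesics *)

(** The bounds on [[0, s]], [[s, t]] and [[t, 1]] add up to exactly [mdist x y], so the triangle
    inequality makes each of them an equality. *)
Lemma lipschitz_geodesic (R : realType) (X : metricType R) (x y : X)
    (gamma : R -> X) :
  gamma 0 = x -> gamma 1 = y ->
  (forall s t : R, 0 <= s -> s <= t -> t <= 1 ->
     mdist (gamma s) (gamma t) <= (t - s) * mdist x y) ->
  geodesic_from_to x y gamma.
Proof.
move=> g0 g1 glip.
have gE s t : 0 <= s <= 1 -> 0 <= t <= 1 ->
    mdist (gamma s) (gamma t) = `|t - s| * mdist x y.
  wlog st : s t / s <= t => [hw|] s01 t01.
    have [st|/ltW ts] := leP s t; first exact: hw.
    by rewrite metric_sym distrC hw.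
  case/andP: s01 => s0 s1; case/andP: t01 => t0 t1.
  rewrite ger0_norm ?subr_ge0//; apply/eqP; rewrite eq_le glip//=.
  have := glip 0 s (lexx 0) s0 s1; have := glip t 1 t0 t1 (lexx 1).
  rewrite g0 g1 => dty dxs.
  have tri (a b c : X) : mdist a c <= mdist a b + mdist b c.
    exact: metric_triangle.
  have := tri x (gamma s) y; have := tri (gamma s) (gamma t) y; lra.
split=> //; split; last by move=> s t; rewrite g0 g1; exact: gE.
apply/subspace_continuousP => s /= /[!in_itv]/= s01.
apply/metricType_numDomainType.cvgrPdist_lt => e e0.
have [le0|gt0] := leP (mdist x y) 0.
  rewrite near_withinE; near=> t => /= /[!in_itv]/= t01; rewrite gE//.
  have -> : mdist x y = 0 by apply/eqP; rewrite eq_le le0 mdist_ge0.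
  by rewrite mulr0.
have e1 : 0 < e / mdist x y by rewrite divr_gt0.
have near_s : \forall t \near nbhs (s : R), `|s - t| < e / mdist x y.
  by apply: nbhsx_ballx.
rewrite near_withinE; apply: filterS near_s => t /= st.
by rewrite in_itv/= => t01; rewrite gE// -ltr_pdivlMr// distrC.
Unshelve. all: by end_near. Qed.

(** * Ratios of sines *)

Lemma sin_double (R : realType) (x : R) : sin (2 * x) = 2 * (cos x * sin x).
Proof. by rewrite !mulr_natl sin_mulr2n. Qed.

(** This is the common value of both interpolation coefficients at the midpoint. *)
Lemma sin_ratio_half (R : realType) (phi : R) : 0 < phi < pi ->
  sin (phi / 2) / sin phi = (2 * cos (phi / 2))^-1.
Proof.
move=> phi_itv; have sy : 0 < sin (phi / 2) by apply: sin_gt0_pi; lra.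
have cy : 0 < cos (phi / 2) by apply: cos_gt0_pihalf; lra.
have -> : sin phi = 2 * (cos (phi / 2) * sin (phi / 2)).
  by rewrite -sin_double mulrCA divff ?mulr1.
by field; rewrite !gt_eqF.
Qed.

(* With [u = (1 - s) phi / 2] and [v = s phi / 2], the two ratios add up to
   [cos (u - v) / cos (u + v)], which exceeds 1 by
   [2 sin u sin v / cos (u + v)]. *)
Lemma sin_interpolation_le (R : realType) (phi s a b B : R) :
  0 < phi < pi -> 0 <= s <= 1 -> 0 <= a <= B -> 0 <= b <= B ->
  sin ((1 - s) * phi) / sin phi * a + sin (s * phi) / sin phi * b <=
  (1 - s) * a + s * b + B * phi ^+ 2 * (s * (1 - s)) / (2 * cos (phi / 2)).
Proof.
move=> phi_itv /andP[s0 s1] /andP[a0 aB] /andP[b0 bB].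
have sp : 0 < sin phi by exact: sin_gt0_pi.
have cy : 0 < cos (phi / 2) by apply: cos_gt0_pihalf; lra.
have ratio_ge t : 0 <= t <= 1 -> t <= sin (t * phi) / sin phi.
  by move=> t01; rewrite ler_pdivlMr// sin_scale//; lra.
have r1 : 1 - s <= sin ((1 - s) * phi) / sin phi by apply: ratio_ge; lra.
have r2 : s <= sin (s * phi) / sin phi by apply: ratio_ge; lra.
(* By [r1] and [r2] each ratio exceeds its weight, so [a] and [b] may be replaced by [B] in the
   excess; only the sum of the ratios then matters. *)
suff sum_ratio : sin ((1 - s) * phi) / sin phi + sin (s * phi) / sin phi <=
    1 + phi ^+ 2 * (s * (1 - s)) / (2 * cos (phi / 2)).
  have B0 : 0 <= B by lra.
  have -> : B * phi ^+ 2 * (s * (1 - s)) / (2 * cos (phi / 2)) =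
      B * (phi ^+ 2 * (s * (1 - s)) / (2 * cos (phi / 2))) by rewrite !mulrA.
  move: r1 r2 sum_ratio.
  set r := sin ((1 - s) * phi) / _; set r' := sin (s * phi) / _.
  set e := _ / (2 * _) => r1 r2 sum_ratio; nra.
set u := (1 - s) * (phi / 2); set v := s * (phi / 2).
have u0 : 0 <= u by rewrite mulr_ge0//; lra.
have v0 : 0 <= v by rewrite mulr_ge0//; lra.
have upi : u <= pi by rewrite /u; nra.
have vpi : v <= pi by rewrite /v; nra.
have -> : (1 - s) * phi = 2 * u by rewrite /u; field.
have -> : s * phi = 2 * v by rewrite /v; field.
have phiE : phi = 2 * (u + v) by rewrite /u /v; field.
have yE : phi / 2 = u + v by rewrite phiE; field.
rewrite yE in cy *; rewrite [X in sin X]phiE in sp *.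
have -> : phi ^+ 2 * (s * (1 - s)) / (2 * cos (u + v)) = 2 * u * v / cos (u + v).
  by rewrite /u /v; field; rewrite gt_eqF.
rewrite !sin_double in sp *.
have sy : 0 < sin (u + v) by nra.
have -> : 2 * (cos u * sin u) / (2 * (cos (u + v) * sin (u + v))) +
    2 * (cos v * sin v) / (2 * (cos (u + v) * sin (u + v))) =
    1 + 2 * sin u * sin v / cos (u + v).
  apply: (@mulIf _ (cos (u + v) * sin (u + v))).
    by rewrite gt_eqF// mulr_gt0.
  have -> : (2 * (cos u * sin u) / (2 * (cos (u + v) * sin (u + v))) +
    2 * (cos v * sin v) / (2 * (cos (u + v) * sin (u + v)))) *
    (cos (u + v) * sin (u + v)) = cos u * sin u + cos v * sin v.
    by field; rewrite !gt_eqF.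
  have -> : (1 + 2 * sin u * sin v / cos (u + v)) * (cos (u + v) * sin (u + v)) =
    (cos (u + v) + 2 * sin u * sin v) * sin (u + v).
    by field; rewrite gt_eqF.
  rewrite cosD sinD.
  (* Inserting [cos ^+ 2 + sin ^+ 2 = 1] makes both sides homogeneous of degree four, within reach
     of [ring]. *)
  have -> : cos u * sin u + cos v * sin v =
    cos u * sin u * (cos v ^+ 2 + sin v ^+ 2) +
    cos v * sin v * (cos u ^+ 2 + sin u ^+ 2) by rewrite !cos2Dsin2 !mulr1.
  ring.
rewrite lerD2l ler_pM2r ?invr_gt0//.
rewrite -(mulrA 2 (sin u)) -(mulrA 2 u) ler_pM2l//.
apply: ler_pM; [| |exact: sin_le_id|exact: sin_le_id].
  by apply: sin_ge0_pi; rewrite u0.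
by apply: sin_ge0_pi; rewrite v0.
Qed.

(** * Subdivision: concatenated geodesics and chains *)

(** Running each piece in time [1 / n] gives a curve with Lipschitz constant [mdist x y], and
    [lipschitz_geodesic] applies. *)
Lemma geodesic_concat (R : realType) (X : metricType R) (n : nat) (x y : X)
    (p : nat -> X) (gamma : nat -> R -> X) :
  (0 < n)%N -> p 0%N = x -> p n = y ->
  (forall i, (i < n)%N -> mdist (p i) (p i.+1) <= mdist x y / n%:R) ->
  (forall i, (i < n)%N -> geodesic_from_to (p i) (p i.+1) (gamma i)) ->
  exists2 Gamma : R -> X, geodesic_from_to x y Gamma &
    forall t, 0 <= t <= 1 -> exists i a,
      [/\ (i < n)%N, 0 <= a <= 1, t * n%:R = i%:R + a & Gamma t = gamma i a].
Proof.
move=> n_gt0 p0 pn pstep pgeo.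
have n0 : 0 < n%:R :> R by rewrite ltr0n.
(* The cap at [n.-1] puts [t = 1] at the end of the last piece instead of the start of a piece
   numbered [n]. *)
pose idx (t : R) : nat := minn (Num.truncn (t * n%:R)) n.-1.
pose Gamma t := gamma (idx t) (t * n%:R - (idx t)%:R).
have GammaE t : 0 <= t <= 1 -> exists i a,
      [/\ (i < n)%N, 0 <= a <= 1, t * n%:R = i%:R + a & Gamma t = gamma i a].
  move=> /andP[t0 t1]; exists (idx t), (t * n%:R - (idx t)%:R); split=> //.
  - by rewrite /idx -[X in (_ < X)%N](prednK n_gt0) ltnS geq_minr.
  - have tn0 : 0 <= t * n%:R by rewrite mulr_ge0// ltW.
    have /andP[lo hi] := truncn_itv tn0.
    have tn1 : t * n%:R <= n%:R by rewrite ler_piMl// ltW.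
    rewrite /idx; have [lt|le] := ltnP (Num.truncn (t * n%:R)) n.-1.
      by move: hi; rewrite -natr1; lra.
    have : n.-1%:R <= (Num.truncn (t * n%:R))%:R :> R by rewrite ler_nat.
    have : n%:R = n.-1%:R + 1 :> R by rewrite natr1 prednK.
    lra.
  - by rewrite addrC subrK.
exists Gamma => //; apply: lipschitz_geodesic.
- have [|i [a [lin a01 e ->]]] := GammaE 0; first by rewrite lexx ler01.
  have i0 : i%:R = 0 :> R by have : 0 <= i%:R :> R by []; lra.
  have -> : a = 0 by lra.
  have -> : i = 0%N by apply/eqP; rewrite -(eqr_nat R) i0.
  by have [_ -> _] := pgeo 0%N n_gt0.
- have [|i [a [lin a01 e ->]]] := GammaE 1; first by rewrite lexx ler01.
  have le_n : i.+1%:R <= n%:R :> R by rewrite ler_nat.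
  have iE : i.+1%:R = i%:R + 1 :> R by rewrite natr1.
  have -> : a = 1 by lra.
  have [_ _ ->] := pgeo i lin; rewrite -pn; congr p.
  by apply/eqP; rewrite -(eqr_nat R); apply/eqP; lra.
- move=> s t s0 st t1.
  have [|i [a [lin a01 sE ->]]] := GammaE s; first by lra.
  have [|j [b [ljn b01 tE ->]]] := GammaE t; first by lra.
  set d := mdist x y / n%:R.
  have d0 : 0 <= d by rewrite divr_ge0 ?mdist_ge0.
  have -> : (t - s) * mdist x y = (j%:R + b - (i%:R + a)) * d.
    by rewrite -sE -tE /d; field; rewrite gt_eqF.
  have stn : i%:R + a <= j%:R + b by rewrite -sE -tE ler_pM2r.
  have gd k u v : (k < n)%N -> 0 <= u <= 1 -> 0 <= v <= 1 ->
      mdist (gamma k u) (gamma k v) <= `|v - u| * d.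
    move=> kn u01 v01; have [[_ kE] k0 k1] := pgeo k kn.
    by rewrite kE// k0 k1 ler_wpM2l// pstep.
  have tri (u v w : X) : mdist u w <= mdist u v + mdist v w.
    exact: metric_triangle.
  have [ltij|ltji|eqij] := ltngtP i j.
  (* The path through [p i.+1] and [p j] has legs at most [(1 - a) d], [(j - i - 1) d] and [b d]. *)
  + have pd k : (i + k < n)%N -> mdist (p i.+1) (p (i + k).+1) <= k%:R * d.
      elim: k => [|k IHk] ikn; first by rewrite addn0 mdistxx mul0r.
      rewrite addnS in ikn *; rewrite (le_trans (tri _ (p (i + k).+1) _))//.
      by rewrite -natr1 mulrDl mul1r lerD ?pstep ?IHk// ltnW.
    have gi : mdist (gamma i a) (p i.+1) <= (1 - a) * d.
      have [_ _ <-] := pgeo i lin; rewrite (le_trans (gd _ _ _ _ _ _))//.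
        by rewrite ler01 lexx.
      by rewrite ger0_norm ?subr_ge0//; lra.
    have gj : mdist (p j) (gamma j b) <= b * d.
      have [_ <- _] := pgeo j ljn; rewrite (le_trans (gd _ _ _ _ _ _))//.
        by rewrite ler01 lexx.
      by rewrite subr0 ger0_norm//; lra.
    have := pd (j - i.+1)%N; rewrite -addSn subnKC// => /(_ (ltnW ljn)) pij.
    have jE : j%:R = (j - i.+1)%:R + (i%:R + 1) :> R.
      by rewrite natr1 -natrD subnK.
    have := tri (gamma i a) (p i.+1) (gamma j b).
    have := tri (p i.+1) (p j) (gamma j b).
    rewrite jE; lra.
  (* [GammaE] leaves the index open at break points. Here [s <= t] forces one break point seen from
     both sides. *)
  + have : j.+1%:R <= i%:R :> R by rewrite ler_nat.
    rewrite -natr1 => ji.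
    have [b1 a0] : b = 1 /\ a = 0 by split; lra.
    have iE : i = j.+1.
      by apply/eqP; rewrite -(eqr_nat R) -natr1; apply/eqP; lra.
    have [_ _ gj1] := pgeo j ljn; have [_ gi0 _] := pgeo i lin.
    have -> : mdist (gamma i a) (gamma j b) = 0.
      by rewrite a0 b1 gi0 gj1 iE mdistxx.
    by rewrite mulr_ge0// subr_ge0.
  + subst j; rewrite (le_trans (gd _ _ _ _ _ _))//.
    by rewrite ger0_norm ?ler_wpM2r//; lra.
Qed.

(** The infimum of the sums need not be attained, hence [eps]. Exchanging one inner vertex yields
    another chain, and the other terms of the two sums cancel. *)
Lemma near_minimal_chain (R : realType) (X : metricType R) (h : X -> R)
    (n : nat) (x y : X) (eps : R) :
  strictly_intrinsic X -> (forall z, 0 <= h z) -> (0 < n)%N -> 0 < eps ->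
  exists p : nat -> X,
    [/\ p 0%N = x, p n = y,
        forall i, (i < n)%N -> mdist (p i) (p i.+1) <= mdist x y / n%:R
      & forall i m, (0 < i < n)%N ->
          mdist (p i.-1) m <= mdist x y / n%:R ->
          mdist m (p i.+1) <= mdist x y / n%:R -> h (p i) <= h m + eps].
Proof.
move=> Xint h0 n_gt0 eps0.
have n0 : 0 < n%:R :> R by rewrite ltr0n.
pose chain (p : nat -> X) := [/\ p 0%N = x, p n = y &
  forall i, (i < n)%N -> mdist (p i) (p i.+1) <= mdist x y / n%:R].
pose E : set R := [set \sum_(i < n.+1) h (p i) | p in chain].
have E_inf : has_inf E.
  split.
    (* Equally spaced points of a geodesic form a chain. *)
    have [g [[_ gE] g0 g1]] := Xint x y.
    exists (\sum_(i < n.+1) h (g (i%:R / n%:R))),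
      (fun i => g (i%:R / n%:R)) => //.
    split=> [||i lin]; first by rewrite mul0r.
      by rewrite divff ?gt_eqF.
    have i01 (k : nat) : (k <= n)%N -> 0 <= (k%:R / n%:R : R) <= 1.
      move=> lkn; rewrite divr_ge0//= ler_pdivrMr// mul1r ler_nat//.
    have stepE : i.+1%:R / n%:R - i%:R / n%:R = n%:R^-1 :> R.
      by rewrite -mulrBl -natrB ?leqnSn// subSnn mul1r.
    rewrite gE ?i01 ?(ltnW lin)// g0 g1 stepE mulrC.
    by rewrite ger0_norm ?invr_ge0// ltW.
  by exists 0 => _ [p _ <-]; apply: sumr_ge0 => i _.
have [_ [p [p0 pn pstep] <-] lt_p] := inf_adherent eps0 E_inf.
exists p; split=> // i m /andP[i0 lin] dm1 dm2.
pose p' j := if j == i then m else p j.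
have chain_p' : chain p'.
  split; rewrite /p'.
  - by rewrite ltn_eqF.
  - by rewrite gtn_eqF.
  - move=> j ljn; have [->|ji] := eqVneq j i; first by rewrite gtn_eqF.
    have [jSi|jSi] := eqVneq j.+1 i; last exact: pstep.
    by rewrite -[j]/(j.+1.-1) jSi.
have : inf E <= \sum_(j < n.+1) h (p' j).
  by apply: ge_inf; [exact: E_inf.2|exists p'].
have lin1 : (i < n.+1)%N by exact: ltnW.
rewrite (bigD1 (Ordinal lin1))//= /p' eqxx.
move: lt_p; rewrite (bigD1 (Ordinal lin1))//=.
have -> : \sum_(j < n.+1 | j != Ordinal lin1) h (if j == i :> nat then m else p j)
    = \sum_(j < n.+1 | j != Ordinal lin1) h (p j).
  by apply: eq_bigr => j; rewrite -val_eqE /= => /negbTE ->.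
lra.
Qed.

(** * Cosine estimates at the subdivision scale *)

(** With [z = y / 2], [1 - cos (2 y) = 8 cos^2 z sin^2 z], and [sin z <= z] is used only there.
    Keeping the factor [1 + cos y] instead of 2 provides the strict gain. *)
Lemma cos_ge_quadratic (R : realType) (y : R) : 0 <= y <= pi ->
  1 - y ^+ 2 * (1 + cos y) <= cos (2 * y).
Proof.
move=> /andP[y0 ypi]; pose z := y / 2.
have yE : y = 2 * z by rewrite /z mulrCA divff ?mulr1.
have z0 : 0 <= z by rewrite /z; lra.
have sz : 0 <= sin z by apply: sin_ge0_pi; rewrite z0 /z; lra.
have -> : cos (2 * y) = 1 - 2 * sin y ^+ 2.
  by rewrite mulr_natl cos_mulr2n cos2sin2 -mulr_natl; ring.
have -> : cos y = 2 * cos z ^+ 2 - 1.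
  by rewrite yE mulr_natl cos_mulr2n -mulr_natl.
have -> : sin y = 2 * (cos z * sin z) by rewrite yE sin_double.
have -> : y ^+ 2 * (1 + (2 * cos z ^+ 2 - 1)) = 8 * (cos z ^+ 2 * z ^+ 2).
  by rewrite yE; ring.
have -> : 2 * (2 * (cos z * sin z)) ^+ 2 = 8 * (cos z ^+ 2 * sin z ^+ 2).
  by ring.
rewrite lerD2l lerN2 ler_pM2l// ler_wpM2l ?sqr_ge0//.
by rewrite ler_sqr ?nnegrE// sin_le_id.
Qed.

Lemma cos_nonincreasing (R : realType) (u v : R) :
  0 <= u -> u <= v -> v <= pi -> cos v <= cos u.
Proof.
by move=> *; rewrite leNgt ltr_cos ?in_itv/= -?leNgt//; apply/andP; split; lra.
Qed.

Lemma one_sub_cos_itv (R : realType) (y : R) :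
  0 < y <= 1 / 2 -> 0 < 1 - cos y <= 1 / 2.
Proof.
have pi2 : 2 <= pi :> R := pi_ge2 R.
move=> y_itv; apply/andP; split.
  by rewrite subr_gt0 -[X in _ < X]cos0 ltr_cos ?in_itv/=; lra.
have sy : 0 <= sin y by apply: sin_ge0_pi; lra.
have sy' : sin y <= y by apply: sin_le_id; lra.
have cy : 0 < cos y by apply: cos_gt0_pihalf; lra.
have := cos2Dsin2 y; nra.
Qed.

(** With [q = 1 - cos (psi / 2) <= 1 / 2], this rests on [1 / (1 - q) <= 1 + 2 q]. *)
Lemma interpolation_excess_le (R : realType) (w psi e : R) :
  0 <= w -> w <= psi -> 0 < psi <= 1 -> 0 <= e ->
  w ^+ 2 * e / (2 * cos (w / 2)) <=
  psi ^+ 2 / 2 * (1 + 2 * (1 - cos (psi / 2))) * e.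
Proof.
have pi2 : 2 <= pi :> R := pi_ge2 R.
move=> w0 wpsi psi_itv e0.
have /andP[q0 q1] : 0 < 1 - cos (psi / 2) <= 1 / 2.
  by apply: one_sub_cos_itv; lra.
have cosw : cos (psi / 2) <= cos (w / 2) by apply: cos_nonincreasing; lra.
rewrite ler_pdivrMr; last by lra.
have -> : psi ^+ 2 / 2 * (1 + 2 * (1 - cos (psi / 2))) * e * (2 * cos (w / 2)) =
    psi ^+ 2 * ((1 + 2 * (1 - cos (psi / 2))) * cos (w / 2)) * e by field.
apply: ler_wpM2r => //.
have le_sq : w ^+ 2 <= psi ^+ 2 by rewrite ler_sqr ?nnegrE//; lra.
apply: (le_trans le_sq); rewrite ler_peMr ?sqr_ge0//; nra.
Qed.

(** * Second differences, parabolas and the grid *)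

(** Split [u = C u + (1 - C) u]: the first term is at most [S / 2 + eps], the second at most
    [k B]. *)
Lemma midpoint_defect_le (R : realFieldType) (B C H S k eps u : R) :
  0 <= u <= B -> 0 < C <= 1 -> 1 - k <= C -> 0 <= eps ->
  u <= H + eps -> 2 * C * H <= S -> 2 * u <= S + 2 * eps + 2 * B * k.
Proof.
move=> /andP[u0 uB] /andP[C0 C1] Ck eps0 uH HS.
have : C * u <= C * H + eps by nra.
have : (1 - C) * u <= k * B by apply: ler_pM; lra.
lra.
Qed.

(** On the grid of step [1 / n] the parabola [P] has second difference [- 2 A / n^2], so [u - P] is
    discretely convex and vanishes at both ends. *)
Lemma discrete_parabola_le (R : realFieldType) (n : nat) (u : nat -> R) (A : R) :
  (0 < n)%N ->
  (forall i, (0 < i < n)%N ->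
     2 * u i <= u i.-1 + u i.+1 + 2 * A / n%:R ^+ 2) ->
  forall i, (i <= n)%N ->
    u i <= (1 - i%:R / n%:R) * u 0%N + i%:R / n%:R * u n +
           A * (i%:R / n%:R * (1 - i%:R / n%:R)).
Proof.
move=> n_gt0 u_defect i lin; have n0 : n%:R != 0 :> R by rewrite pnatr_eq0 -lt0n.
pose P t := (1 - t) * u 0%N + t * u n + A * (t * (1 - t)).
rewrite -subr_le0 -/(P (i%:R / n%:R)).
apply: (@discrete_convex_le0 _ n (fun i => u i - P (i%:R / n%:R))) => //.
- by rewrite /P !mul0r subr0 mul1r mulr0 !addr0 subrr.
- by rewrite /P divff// subrr mulr0 mul0r mulr0 add0r mul1r addr0 subrr.
- move=> [|j]// /u_defect; rewrite [j.+1.-1]/=.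
  have -> : P (j.+1%:R / n%:R) = (P (j%:R / n%:R) + P (j.+2%:R / n%:R) +
      2 * A / n%:R ^+ 2) / 2.
    by rewrite /P -!natr1; field.
  lra.
Qed.

(** The distances [al] and [be] from [t] to its neighbouring grid points are at most [t] and
    [1 - t], and both at most [1 / 18]. Whichever of [t], [1 - t] is at least [1 / 2] absorbs the
    factor 9. *)
Lemma subdivision_gap (R : realFieldType) (n i : nat) (a t : R) :
  (18 <= n)%N -> (i < n)%N -> 0 <= a <= 1 -> t * n%:R = i%:R + a ->
  9 * ((a * (1 - a)) / n%:R ^+ 2) <= t * (1 - t).
Proof.
move=> n18 lin /andP[a0 a1] tE.
have {}n18 : 18 <= n%:R :> R by rewrite ler_nat.
have n0 : 0 < n%:R :> R by lra.
have i0 : 0 <= i%:R :> R by [].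
have i1 : i%:R + 1 <= n%:R :> R by rewrite natr1 ler_nat.
pose al := a / n%:R; pose be := (1 - a) / n%:R.
have -> : a * (1 - a) / n%:R ^+ 2 = al * be.
  by rewrite /al /be; field; rewrite gt_eqF.
have al0 : 0 <= al by rewrite divr_ge0// ltW.
have be0 : 0 <= be by rewrite divr_ge0 ?subr_ge0// ltW.
have al1 : al <= 1 / 18 by rewrite ler_pdivrMr//; lra.
have be1 : be <= 1 / 18 by rewrite ler_pdivrMr//; lra.
have al_t : al <= t by rewrite ler_pdivrMr//; lra.
have be_t : be <= 1 - t by rewrite ler_pdivrMr//; lra.
have [t_half|t_half] := leP t (1 / 2).
  by rewrite mulrCA ler_pM//; lra.
by rewrite mulrA ler_pM//; lra.
Qed.

(** * From local to global semiconvexity *)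

(** The local midpoint bound controls the vertices of a near-minimal chain; the local interpolation
    bound controls the curve between them. *)
Lemma semiconvex_of_local (R : realType) (X : metricType R) (h : X -> R)
    (B c : R) :
  strictly_intrinsic X -> 0 < c -> 0 < B -> (forall z, 0 <= h z <= B) ->
  (forall x y : X, c * mdist x y <= 1 ->
     exists2 gamma : R -> X, geodesic_from_to x y gamma &
       h (gamma 2^-1) <= (h x + h y) / (2 * cos (c * mdist x y / 2)) /\
       forall t, 0 <= t <= 1 ->
         h (gamma t) <= (1 - t) * h x + t * h y +
           B * (c * mdist x y) ^+ 2 * (t * (1 - t)) /
             (2 * cos (c * mdist x y / 2))) ->
  forall x y : X, exists2 gamma : R -> X, geodesic_from_to x y gamma &
    forall t, 0 <= t <= 1 ->
      h (gamma t) <= (1 - t) * h x + t * h y +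
        B * (c * mdist x y) ^+ 2 / 2 * (t * (1 - t)).
Proof.
move=> Xint c0 B0 hB hloc x y; set phi := c * mdist x y.
have [phi_eq0|phi_neq0] := eqVneq phi 0.
  have [|gamma ggeo [_ gt]] := hloc x y; first by rewrite -/phi phi_eq0 ler01.
  exists gamma => // t t01; have := gt t t01.
  by rewrite -/phi phi_eq0 expr0n/= !mulr0 !mul0r.
have phi0 : 0 < phi by rewrite lt_def phi_neq0 mulr_ge0 ?mdist_ge0// ltW.
(* [2 phi <= n] keeps two consecutive links within the range of [hloc]; 18 serves
   [subdivision_gap]. *)
pose n := (Num.truncn (2 * phi) + 18)%N.
have n_gt0 : (0 < n)%N by rewrite /n addn_gt0 orbT.
have n18 : (18 <= n)%N by exact: leq_addl.
have nphi : 2 * phi <= n%:R.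
  rewrite (le_trans (ltW (truncnS_gt _)))// ler_nat /n -addn1 leq_add2l//.
have n0 : 0 < n%:R :> R by rewrite ltr0n.
set r := mdist x y / n%:R.
pose psi := phi / n%:R; pose q := 1 - cos (psi / 2).
have psiE : c * r = psi by rewrite /psi /phi mulrA.
have psi0 : 0 < psi by rewrite divr_gt0.
have psi1 : psi <= 1 / 2 by rewrite ler_pdivrMr//; lra.
have pi2 : 2 <= pi :> R := pi_ge2 R.
have /andP[q0 q1] : 0 < q <= 1 / 2 by apply: one_sub_cos_itv; lra.
have cos_psi_ge : 1 - (psi ^+ 2 / 2 - psi ^+ 2 * q / 4) <= cos psi.
  have : 1 - (psi / 2) ^+ 2 * (1 + cos (psi / 2)) <= cos (2 * (psi / 2)).
    by apply: cos_ge_quadratic; lra.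
  rewrite mulrCA divff// mulr1; apply: le_trans; rewrite /q; lra.
have cos_psi_gt0 : 0 < cos psi by apply: cos_gt0_pihalf; lra.
(* The cosine estimate gains [B psi^2 q / 2] in the second difference. Entering twice, [eps] spends
   half of this; the rest is the factor [1 - q / 4] of [A]. *)
pose eps := B * psi ^+ 2 * q / 8.
have eps0 : 0 < eps by rewrite divr_gt0// mulr_gt0// mulr_gt0// exprn_gt0.
have h0 z : 0 <= h z by case/andP: (hB z).
have [p [p0 pn pstep pmin]] := near_minimal_chain x y Xint h0 n_gt0 eps0.
rewrite -/r in pstep pmin.
pose A := B * phi ^+ 2 / 2 * (1 - q / 4).
have h_defect i : (0 < i < n)%N ->
    2 * h (p i) <= h (p i.-1) + h (p i.+1) + 2 * A / n%:R ^+ 2.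
  move=> /andP[i0 lin]; set w := mdist (p i.-1) (p i.+1).
  have w_le : w <= r + r.
    apply: (le_trans (metric_triangle _ (p i) _)); apply: lerD; last exact: pstep.
    by have := pstep i.-1; rewrite prednK//; apply; exact: leq_trans lin.
  have cw0 : 0 <= c * w by rewrite mulr_ge0 ?mdist_ge0// ltW.
  have cw : c * w <= psi + psi by rewrite -psiE -mulrDr ler_wpM2l// ltW.
  have [|gamma [[_ gE] g0 g1] [gmid _]] := hloc (p i.-1) (p i.+1).
    by apply: (le_trans cw); lra.
  rewrite -/w in gmid; rewrite g0 g1 -/w in gE.
  have half_itv : 0 <= (2^-1 : R) <= 1 by lra.
  have w_half : 2^-1 * w <= r by rewrite ler_pdivrMl//; lra.
  (* As [w <= 2 r], the midpoint is within [r] of both neighbours and may replace [p i]. *)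
  have uH : h (p i) <= h (gamma 2^-1) + eps.
    apply: pmin; first by rewrite i0.
    - by rewrite -g0 gE ?lexx ?ler01// subr0 ger0_norm.
    - have half_sub : 1 - 2^-1 = 2^-1 :> R by field.
      by rewrite -g1 gE ?lexx ?ler01// half_sub ger0_norm.
  have cosw : cos psi <= cos (c * w / 2) by apply: cos_nonincreasing; lra.
  have HS : 2 * cos psi * h (gamma 2^-1) <= h (p i.-1) + h (p i.+1).
    move: gmid; rewrite ler_pdivlMr; last by rewrite mulr_gt0//; lra.
    by apply: le_trans; rewrite [leRHS]mulrC ler_wpM2r// ler_pM2l.
  have C_itv : 0 < cos psi <= 1 by rewrite cos_psi_gt0 cos_le1.
  have := midpoint_defect_le (hB (p i)) C_itv cos_psi_ge (ltW eps0) uH HS.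
  have -> : 2 * A / n%:R ^+ 2 =
      2 * eps + 2 * B * (psi ^+ 2 / 2 - psi ^+ 2 * q / 4).
    by rewrite /A /eps /psi; field; rewrite gt_eqF.
  by rewrite addrA.
have h_parabola := discrete_parabola_le n_gt0 h_defect.
rewrite p0 pn in h_parabola.
pose good i (gamma : R -> X) := geodesic_from_to (p i) (p i.+1) gamma /\
  forall a, 0 <= a <= 1 -> h (gamma a) <= (1 - a) * h (p i) + a * h (p i.+1) +
    B * (psi ^+ 2 / 2 * (1 + 2 * q) * (a * (1 - a))).
(* Choice asks for a curve at every index; from [n] on a constant one is a placeholder. *)
have /choice[gamma gammaP] :
    forall i, exists gamma, (i < n)%N -> good i gamma.
  move=> i; have [lin|_] := ltnP i n; last by exists (fun=> x).
  have cw0 : 0 <= c * mdist (p i) (p i.+1) by rewrite mulr_ge0 ?mdist_ge0// ltW.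
  have cw : c * mdist (p i) (p i.+1) <= psi.
    by rewrite -psiE ler_wpM2l ?pstep// ltW.
  have [|gamma ggeo [_ gfill]] := hloc (p i) (p i.+1).
    by apply: (le_trans cw); lra.
  exists gamma => _; split=> // a a01; apply: (le_trans (gfill a a01)).
  rewrite lerD2l -2!mulrA ler_pM2l// mulrA.
  by apply: interpolation_excess_le => //; [lra|apply: mulr_ge0; lra].
have [Gamma Ggeo GE] := geodesic_concat n_gt0 p0 pn pstep
  (fun i lin => proj1 (gammaP i lin)).
exists Gamma => // t t01; have [i [a [lin a01 tE ->]]] := GE t t01.
have [_ /(_ a a01)] := gammaP i lin; move/le_trans; apply.
have a0 : 0 <= a by case/andP: a01.
have a1 : 0 <= 1 - a by rewrite subr_ge0; case/andP: a01.
have Pi := ler_wpM2l a1 (h_parabola i (ltnW lin)).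
have Pi1 := ler_wpM2l a0 (h_parabola i.+1 lin).
apply: (le_trans (lerD (lerD Pi Pi1) (lexx _))).
(* The chain gains [q / 4] on [t (1 - t)] and filling in loses
   [2 q + q / 4 = 9 q / 4] on [a (1 - a) / n ^ 2], hence the factor 9. *)
have gap := subdivision_gap n18 lin a01 tE.
have tE' : t = (i%:R + a) / n%:R by rewrite -tE mulfK// gt_eqF.
rewrite -subr_ge0.
set rhs := (X in 0 <= X).
have -> : rhs = B * phi ^+ 2 / 2 * (q / 4) *
    (t * (1 - t) - 9 * (a * (1 - a) / n%:R ^+ 2)).
  by rewrite /rhs /A /psi tE' -natr1; field; rewrite gt_eqF.
rewrite mulr_ge0 ?subr_ge0//.
have B_ge0 := ltW B0; have q_ge0 := ltW q0.
by apply: mulr_ge0; apply: divr_ge0 => //; apply: mulr_ge0; rewrite ?sqr_ge0.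
Qed.

(** * The transform and the coefficients [sigma] *)

Lemma exp_transform_ge0 (R : realType) (X : metricType R) (N : R)
    (f : X -> \bar R) (x : X) : (0 <= exp_transform N f x)%E.
Proof.
by rewrite /exp_transform; case: (f x) => [r||]//; rewrite lee_fin expR_ge0.
Qed.

Lemma fin_dom_exp_transform (R : realType) (X : metricType R) (N : R)
    (f : X -> \bar R) : fin_dom (exp_transform N f) `<=` lty_dom f.
Proof.
move=> x; rewrite /fin_dom /lty_dom /exp_transform /=.
by case: (f x) => [r||]//; rewrite ltry.
Qed.

(** For [0 <= K] only the [sinh] branch and the branch [t] can occur. *)
Lemma sigma_le_id (R : realType) (K N t theta : R) :
  0 <= K -> N < 0 -> 0 <= theta -> 0 <= t <= 1 ->
  (sigma K N t theta <= t%:E)%E.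
Proof.
move=> K0 N0 theta0 t01; rewrite /sigma.
have Kth0 : 0 <= K * theta ^+ 2 by rewrite mulr_ge0// sqr_ge0.
rewrite [K * _ < 0]ltNge Kth0 andbF /= lt_def Kth0 andbT.
case: eqVneq => //= Kth_neq0.
have K_neq0 : K != 0 by apply: contraNneq Kth_neq0 => ->; rewrite mul0r.
have theta_neq0 : theta != 0.
  by apply: contraNneq Kth_neq0 => ->; rewrite expr0n mulr0.
rewrite lee_fin /Defs.sfun ltNge K0 /= (negbTE K_neq0).
set c := Num.sqrt _.
have c0 : 0 < c.
  by rewrite sqrtr_gt0 mulNr -mulrN -invrN divr_gt0 ?oppr_gt0// lt_def K_neq0.
have x0 : 0 < theta * c by rewrite mulr_gt0// lt_def theta_neq0.
have sh0 : 0 < sinh (theta * c).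
  by rewrite /sinh divr_gt0// subr_gt0 ltr_expR; lra.
have -> : sinh (t * theta * c) / c / (sinh (theta * c) / c) =
    sinh (t * theta * c) / sinh (theta * c) by field; rewrite !gt_eqF.
by rewrite ler_pdivrMr// -mulrA sinh_scale// ltW.
Qed.

(** Since [K = N c^2], the condition [N pi^2 < K theta^2] reads [c theta < pi]. *)
Lemma sigma_sinE (R : realType) (K N t theta : R) :
  K < 0 -> N < 0 -> 0 < theta -> Num.sqrt (K / N) * theta < pi ->
  sigma K N t theta = (sin (t * (Num.sqrt (K / N) * theta)) /
                       sin (Num.sqrt (K / N) * theta))%:E.
Proof.
move=> K0 N0 theta0; set c := Num.sqrt _ => cth.
have KN0 : 0 < K / N by rewrite -mulrNN -invrN divr_gt0 ?oppr_gt0.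
have c0 : 0 < c by rewrite sqrtr_gt0.
have KE : K = N * c ^+ 2.
  by rewrite sqr_sqrtr ?ltW// mulrCA divff ?mulr1// lt_eqF.
have cth0 : 0 < c * theta by exact: mulr_gt0.
rewrite /sigma ifT; last first.
  apply/orP; left; apply/andP; split.
    rewrite {1}KE -mulrA -exprMn ltr_nM2l// ltr_sqr ?nnegrE ?pi_ge0//.
    exact: ltW.
  by rewrite pmulr_llt0// exprn_gt0.
rewrite /Defs.sfun K0 -/c; congr _%:E.
rewrite -(mulrA t) (mulrC theta).
have sn0 : 0 < sin (c * theta) by apply: sin_gt0_pi; rewrite cth0.
by field; rewrite !gt_eqF.
Qed.

Lemma sigma0 (R : realType) (K N t : R) : sigma K N t 0 = t%:E.
Proof. by rewrite /sigma expr0n/= mulr0 !ltxx !andbF/= eqxx. Qed.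

Theorem proposition2p10 (R : realType) (X : metricType R)
    (X_intrinsic : strictly_intrinsic X)
    (Xc : metricType R) (iota : X -> Xc)
    (Xc_completion : metric_completion iota)
    (Xc_geodesic : geodesic_space Xc)
    (f : X -> \bar R) (f_proper : fin_dom f !=set0) :
  (forall K N : R, 0 <= K -> N < 0 ->
     KN_convex K N f -> lambda_convex 0 (exp_transform N f))
  /\
  (forall K N M : R, K < 0 -> N < 0 ->
     (forall x : X, (f x <= M%:E)%E) ->
     KN_convex K N f ->
     lambda_convex (- (K / N) * expR (- M / N)) (exp_transform N f)).
Proof.
split=> [K N K0 N0 fKN x0 x1 fx0 fx1|K N M K0 N0 fM fKN].
  have [||/lt_geF|gamma ggeo gle] := fKN x0 x1 _ _ _.
  - exact: fin_dom_exp_transform fx0.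
  - exact: fin_dom_exp_transform fx1.
  - by rewrite K0.
  exists gamma => // t t01; rewrite (le_trans (gle t t01))//.
  rewrite !mul0r oppe0 adde0.
  by apply: leeD; apply: lee_wpmul2r; rewrite ?exp_transform_ge0// sigma_le_id
    ?mdist_ge0//; lra.
pose B := expR (- M / N); pose c := Num.sqrt (K / N).
(* The bound [M] excludes the value [+oo], so the transform is real-valued. *)
pose h x := fine (exp_transform N f x).
have hE x : exp_transform N f x = (h x)%:E.
  by rewrite /h /exp_transform; case: (f x) (fM x).
have hB x : 0 <= h x <= B.
  rewrite -lee_fin -hE exp_transform_ge0/= /h /exp_transform.
  case: (f x) (fM x) => [r||]//= rM; last exact: expR_ge0.
  by rewrite ler_expR ler_ndivlMr ?mulfVK ?lt_eqF// lerN2 -lee_fin.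
have KN0 : 0 < K / N by rewrite -mulrNN -invrN divr_gt0 ?oppr_gt0.
have c0 : 0 < c by rewrite sqrtr_gt0.
have f_lty x : lty_dom f x by exact: le_lt_trans (fM x) (ltry _).
have pi2 : 2 <= pi :> R := pi_ge2 R.
move=> x0 x1 _ _.
have [|gamma ggeo gle] :=
  @semiconvex_of_local R X h B c X_intrinsic c0 (expR_gt0 _) hB _ x0 x1.
  move=> x y cd1.
  have [_|gamma ggeo gle] := fKN x y (f_lty x) (f_lty y).
    (* The admissible radius is [pi / c], and [c * mdist x y <= 1 < pi]. *)
    rewrite -[N / K]invf_div sqrtrV ?ltW// -/c ltr_pdivlMr// mulrC.
    by apply: le_lt_trans cd1 _; lra.
  exists gamma => //.
  (* At distance 0 the sine quotient degenerates, whereas [sigma] equals [t]. *)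
  have [d0|d_neq0] := eqVneq (mdist x y) 0.
    have gle0 t : 0 <= t <= 1 -> h (gamma t) <= (1 - t) * h x + t * h y.
      by move=> t01; have := gle t t01; rewrite d0 !sigma0 !hE -!EFinM lee_fin.
    rewrite d0 mulr0 mul0r cos0 expr0n/= mulr0 mulr1; split=> [|t t01].
      by have := gle0 2^-1; lra.
    by rewrite !mul0r addr0 gle0.
  have d0 : 0 < mdist x y by rewrite lt_def d_neq0 mdist_ge0.
  have phi_itv : 0 < c * mdist x y < pi.
    by rewrite mulr_gt0//=; apply: le_lt_trans cd1 _; lra.
  have gle' t : 0 <= t <= 1 -> h (gamma t) <=
      sin ((1 - t) * (c * mdist x y)) / sin (c * mdist x y) * h x +
      sin (t * (c * mdist x y)) / sin (c * mdist x y) * h y.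
    move=> t01; have := gle t t01.
    case/andP: phi_itv => _ phi_pi.
    by rewrite !sigma_sinE// !hE -!EFinM lee_fin.
  split=> [|t t01].
    have := gle' 2^-1.
    have -> : 1 - 2^-1 = 2^-1 :> R by field.
    rewrite (mulrC 2^-1) sin_ratio_half// -mulrDr mulrC; apply.
    by lra.
  by rewrite (le_trans (gle' t t01))// sin_interpolation_le.
exists gamma => // t t01; rewrite !hE -!EFinM lee_fin.
(* Here [c^2 = K / N] turns [B c^2] into [- lambda]. *)
rewrite (le_trans (gle t t01))// exprMn sqr_sqrtr ?(ltW KN0)//.
by rewrite /B; lra.
Qed.
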